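(* Let $(X,d,A)$ be a metric pair and let $E$ be a real or complex Banach space. The assignment $f\mapsto(\Delta_h f)_{h\in K(X,A)}$, where $(\Delta_h f)(x)=f(x+h)-f(x)$, induces an isometric linear isomorphism $$\operatorname{Lip}(K(X,A),E)/E\;\cong\; Z^1\bigl(K(X,A),\ell^\infty(K(X,A),E)\bigr).$$
   Context: Virtual persistence diagrams. A metric pair $(X,d,A)$ is a metric space $(X,d)$ with a nonempty subset $A\subseteq X$. Let $q\colon X\to X/A$ collapse $A$ to one point $[A]$, put $d(x,A)=\inf_{a\in A}d(x,a)$ and $d_1(x,y)=\min\{d(x,y),\,d(x,A)+d(y,A)\}$. The induced distance $\overline d_1(q(x),q(y))=d_1(x,y)$ on $X/A$ is taken to be a metric (equivalently, $A$ is closed). $D(X)$ is the free commutative monoid on $X$ (finite formal sums), and $D(X,A)=D(X)/D(A)\cong D(X\setminus A)$ is the monoid of persistence diagrams. A matching between $\alpha,\beta\in D(X,A)$ is $\sigma=\sum_{i=1}^n(x_i,y_i)\in D(X\times X)$ with $\sum_i x_i=\alpha$ and $\sum_i y_i=\beta$ modulo $D(A)$; $W_1(\alpha,\beta)=\inf_\sigma\sum_i d_1(x_i,y_i)$ over all matchings. $W_1$ is translation-invariant. $K(X,A)$ is the Grothendieck group of $D(X,A)$ (an abelian group whose elements are $\alpha-\beta$ with $\alpha,\beta\in D(X,A)$) with the translation-invariant metric $\rho(\alpha-\beta,\gamma-\delta)=W_1(\alpha+\delta,\gamma+\beta)$. Function spaces. $\operatorname{Lip}(K(X,A),E)$ is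 the vector space of functions $f\colon K(X,A)\to E$ with $\operatorname{Lip}(f)=\sup_{x\ne y}\|f(x)-f(y)\|_E/\rho(x,y)<\infty$. $E$ is identified with the subspace of constant functions, and $\operatorname{Lip}(\cdot)$ is the norm on $\operatorname{Lip}(K(X,A),E)/E$. $\ell^\infty(K(X,A),E)$ is the space of bounded functions with sup norm, and $(\tau_k u)(x)=u(x+k)$. $Z^1(K(X,A),\ell^\infty(K(X,A),E))$ is the vector space of families $b=(b_h)_{h\in K(X,A)}$ with $b_h\in\ell^\infty(K(X,A),E)$, $b_{h+k}=\tau_k b_h+b_k$ for all $h,k\in K(X,A)$, and $\|b\|_{Z^1}=\sup_{h\neq 0}\|b_h\|_\infty/\rho(h,0)<\infty$; $\|\cdot\|_{Z^1}$ is its norm. *)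

(* Defs.v *)
(* For a metric space X and A : set X:
     fcm X       is the free commutative monoid D(X), fcm_on A its submonoid D(A),
     diag A      is D(X, A) = D(X) / D(A),
     vdiag A     is K(X, A), the Grothendieck group of diag A,
     lipmod A E  is Lip(K(X, A), E) / E, with norm lipmod_norm,
     Z1 A E      is Z^1(K(X, A), l^oo(K(X, A), E)), with norm Z1norm. *)
Set Warnings "-notation-overridden,-ambiguous-paths".
Set Warnings "-notation-incompatible-prefix,-redundant-canonical-projection".
From HB Require Import structures.
From mathcomp Require Import all_boot all_order all_algebra generic_quotient.
From mathcomp Require Import ring_quotient finmap multiset.
From mathcomp Require Import all_classical all_reals all_analysis.
From mathcomp Require Import complex.

Set Implicit Arguments.
Unset Strict Implicit.
Unset Printing Implicit Defensive.

Import Order.TTheory GRing.Theory Num.Theory.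
Import numFieldNormedType.Exports.

Local Open Scope classical_set_scope.
Local Open Scope ring_scope.
Local Open Scope quotient_scope.

Section MonoidQuotient.
Variables (M : nmodType) (N : addrClosed M).

Definition mquot_equiv (x y : M) : bool :=
  `[< exists a b, [/\ a \in N, b \in N & x + a = y + b] >].

Lemma mquot_equiv_is_equiv : equiv_class_of mquot_equiv.
Proof.
split=> [x|x y|y x z].
- by apply/asboolP; exists 0, 0; rewrite rpred0.
- apply/asboolP/asboolP => -[a [b [aN bN e]]]; exists b, a; split=> //.
- move=> /asboolP[a [b [aN bN e]]] /asboolP[c [d [cN dN e']]].
  apply/asboolP; exists (a + c), (d + b); rewrite !rpredD//; split=> //.
  by rewrite addrA e addrAC e' addrA.
Qed.

Canonical mquot_equiv_equiv := EquivRelPack mquot_equiv_is_equiv.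
Canonical mquot_equiv_encModRel := defaultEncModRel mquot_equiv.

Definition mquot := {eq_quot mquot_equiv}.
HB.instance Definition _ : EqQuotient M mquot_equiv mquot :=
  EqQuotient.on mquot.
HB.instance Definition _ := Choice.on mquot.

Definition mquot_zero : mquot := lift_cst mquot 0.
Definition mquot_add := lift_op2 mquot +%R.

Canonical pi_mquot_zero_morph := PiConst mquot_zero.

Lemma pi_mquot_add : {morph \pi : x y / x + y >-> mquot_add x y}.
Proof.
move=> x y /=; unlock mquot_add; apply/eqP; rewrite piE.
have /eqP := reprK (\pi_mquot x); rewrite piE => /asboolP[a [b [aN bN e]]].
have /eqP := reprK (\pi_mquot y); rewrite piE => /asboolP[c [d [cN dN e']]].
apply/asboolP; exists (b + d), (a + c); rewrite !rpredD//; split=> //.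
by rewrite addrACA -e -e' addrACA.
Qed.
Canonical pi_mquot_add_morph := PiMorph2 pi_mquot_add.

Lemma mquot_addA : associative mquot_add.
Proof. by move=> x y z; rewrite -[x]reprK -[y]reprK -[z]reprK !piE addrA. Qed.

Lemma mquot_addC : commutative mquot_add.
Proof. by move=> x y; rewrite -[x]reprK -[y]reprK !piE addrC. Qed.

Lemma mquot_add0 : left_id mquot_zero mquot_add.
Proof. by move=> x; rewrite -[x]reprK !piE add0r. Qed.

HB.instance Definition _ :=
  GRing.isNmodule.Build mquot mquot_addA mquot_addC mquot_add0.

Lemma pi_mquotD (x y : M) : \pi_mquot (x + y) = \pi_mquot x + \pi_mquot y.
Proof. exact: pi_mquot_add. Qed.

End MonoidQuotient.

Section Grothendieck.
Variable M : nmodType.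

Definition groth_equiv (x y : M * M) : bool :=
  `[< exists k : M, x.1 + y.2 + k = y.1 + x.2 + k >].

Lemma groth_equiv_is_equiv : equiv_class_of groth_equiv.
Proof.
split=> [x|x y|y x z].
- by apply/asboolP; exists 0.
- by apply/asboolP/asboolP => -[k e]; exists k.
- move=> /asboolP[k e] /asboolP[l e'].
  apply/asboolP; exists (y.1 + y.2 + k + l).
  rewrite (AC (2*4) ((1*4*5)*(3*2*6)))/= e e'.
  by rewrite (AC (3*3) ((4*2)*(1*5*3*6))).
Qed.

Canonical groth_equiv_equiv := EquivRelPack groth_equiv_is_equiv.
Canonical groth_equiv_encModRel := defaultEncModRel groth_equiv.

Definition groth := {eq_quot groth_equiv}.
HB.instance Definition _ : EqQuotient (M * M)%type groth_equiv groth :=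
  EqQuotient.on groth.
HB.instance Definition _ := Choice.on groth.

Definition groth_zero : groth := lift_cst groth 0.
Definition groth_add := lift_op2 groth +%R.
Definition groth_opp := lift_op1 groth (fun x : M * M => (x.2, x.1)).

Canonical pi_groth_zero_morph := PiConst groth_zero.

Lemma pi_groth_opp : {morph \pi : x / (x.2, x.1) >-> groth_opp x}.
Proof.
move=> x; unlock groth_opp; apply/eqP; rewrite piE.
have /eqP := reprK (\pi_groth x); rewrite piE => /asboolP[k e].
by apply/asboolP; exists k => /=; rewrite (addrC x.2) (addrC _ x.1).
Qed.
Canonical pi_groth_opp_morph := PiMorph1 pi_groth_opp.

Lemma pi_groth_add : {morph \pi : x y / x + y >-> groth_add x y}.
Proof.
move=> x y /=; unlock groth_add; apply/eqP; rewrite piE.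
have /eqP := reprK (\pi_groth x); rewrite piE => /asboolP[k e].
have /eqP := reprK (\pi_groth y); rewrite piE => /asboolP[l e'].
apply/asboolP; exists (k + l) => /=; apply: esym.
rewrite (AC ((2*2)*2) ((1*3*5)*(2*4*6)))/= e e'.
by rewrite (AC (3*3) ((1*4)*(2*5)*(3*6))).
Qed.
Canonical pi_groth_add_morph := PiMorph2 pi_groth_add.

Lemma groth_addA : associative groth_add.
Proof. by move=> x y z; rewrite -[x]reprK -[y]reprK -[z]reprK !piE addrA. Qed.

Lemma groth_addC : commutative groth_add.
Proof. by move=> x y; rewrite -[x]reprK -[y]reprK !piE addrC. Qed.

Lemma groth_add0 : left_id groth_zero groth_add.
Proof. by move=> x; rewrite -[x]reprK !piE add0r. Qed.

Lemma groth_addN : left_inverse groth_zero groth_opp groth_add.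
Proof.
move=> x; rewrite -[x]reprK !piE; apply/eqP; rewrite piE.
by apply/asboolP; exists 0 => /=; rewrite !addr0 add0r addrC.
Qed.

HB.instance Definition _ :=
  GRing.isZmodule.Build groth groth_addA groth_addC groth_add0 groth_addN.

Lemma pi_grothD (x y : M * M) : \pi_groth (x + y) = \pi_groth x + \pi_groth y.
Proof. exact: pi_groth_add. Qed.

End Grothendieck.

Section ModuleQuotient.
Variables (F : pzRingType) (V : lmodType F) (S : submodClosed V).

Lemma lmquot_pred_zmod_closed : zmod_closed (S : {pred V}).
Proof.
split; first exact: rpred0.
by move=> x y xS yS; rewrite -scaleN1r rpredD ?rpredZ.
Qed.

Definition lmquot_pred : {pred V} := S.
HB.instance Definition _ :=
  GRing.isZmodClosed.Build V lmquot_pred lmquot_pred_zmod_closed.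

Definition lmquot := Quotient.quot lmquot_pred.
HB.instance Definition _ := GRing.Zmodule.on lmquot.
HB.instance Definition _ : EqQuotient V (Quotient.equiv lmquot_pred) lmquot :=
  EqQuotient.on lmquot.

Definition lmquot_scale (a : F) := lift_op1 lmquot ( *:%R a).

Lemma pi_lmquot_scale a : {morph \pi : x / a *: x >-> lmquot_scale a x}.
Proof.
move=> x; unlock lmquot_scale; apply/eqP; rewrite piE Quotient.equivE.
have /eqP := reprK (\pi_lmquot x); rewrite piE Quotient.equivE => e.
rewrite -scalerBr -opprB scalerN -scaleNr.
exact: (@rpredZ _ _ S).
Qed.
Canonical pi_lmquot_scale_morph a := PiMorph1 (pi_lmquot_scale a).

Lemma pi_lmquotD (x y : V) :
  \pi_lmquot (x + y) = \pi_lmquot x + \pi_lmquot y.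
Proof. exact: (Quotient.pi_add lmquot_pred). Qed.

Lemma lmquot_scaleA a b (v : lmquot) :
  lmquot_scale a (lmquot_scale b v) = lmquot_scale (a * b) v.
Proof. by rewrite -[v]reprK !piE scalerA. Qed.

Lemma lmquot_scale1 : left_id 1 lmquot_scale.
Proof. by move=> v; rewrite -[v]reprK !piE scale1r. Qed.

Lemma lmquot_scaleDr : right_distributive lmquot_scale +%R.
Proof.
move=> a u v; rewrite -[u]reprK -[v]reprK -pi_lmquotD.
by rewrite -!pi_lmquot_scale -pi_lmquotD scalerDr.
Qed.

Lemma lmquot_scaleDl v : {morph lmquot_scale^~ v : a b / a + b}.
Proof.
move=> a b; rewrite -[v]reprK.
by rewrite -!pi_lmquot_scale -pi_lmquotD scalerDl.
Qed.

HB.instance Definition _ := GRing.Zmodule_isLmodule.Build F lmquot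
  lmquot_scaleA lmquot_scale1 lmquot_scaleDr lmquot_scaleDl.

Lemma pi_lmquotZ a (x : V) : \pi_lmquot (a *: x) = a *: \pi_lmquot x.
Proof. exact: pi_lmquot_scale. Qed.

End ModuleQuotient.

Definition fcm (T : choiceType) := {mset T}%mset.
HB.instance Definition _ (T : choiceType) := Choice.on (fcm T).

Section FreeCommutativeMonoid.
Variable T : choiceType.

Definition fcm_add (a b : fcm T) : fcm T := msetD a b.

Lemma fcm_addA : associative fcm_add.
Proof. by move=> a b c; exact: msetDA. Qed.

Lemma fcm_addC : commutative fcm_add.
Proof. by move=> a b; exact: msetDC. Qed.

Lemma fcm_add0 : left_id mset0 fcm_add.
Proof. by move=> a; exact: mset0D. Qed.

HB.instance Definition _ :=
  GRing.isNmodule.Build (fcm T) fcm_addA fcm_addC fcm_add0.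

Definition fcm_gen (x : T) : fcm T := msetn 1 x.

Variable A : set T.

Definition fcm_on : {pred fcm T} :=
  fun a : fcm T => all (fun x => x \in A) (a : {mset T}%mset).

Lemma fcm_on_addr_closed : addr_closed fcm_on.
Proof.
split; first by apply/allP => x; rewrite in_mset0.
move=> a b /allP aA /allP bA; apply/allP => x.
by rewrite in_msetD => /orP[/aA|/bA].
Qed.
HB.instance Definition _ := GRing.isAddClosed.Build (fcm T) fcm_on
  fcm_on_addr_closed.

End FreeCommutativeMonoid.

Section VirtualPersistenceDiagrams.
Variables (R : realType) (X : metricType R) (A : set X).

Definition setdist (x : X) : R := inf [set mdist x a | a in A].

Definition d1 (x y : X) : R :=
  Num.min (mdist x y) (setdist x + setdist y).

Definition diag := mquot (@fcm_on X A).
HB.instance Definition _ := GRing.Nmodule.on diag.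

Definition diag_of (a : fcm X) : diag := \pi_(mquot (@fcm_on X A)) a.

Definition is_matching (a b : diag) (s : fcm (X * X)%type) : Prop :=
  diag_of (\sum_(p <- (s : {mset _}%mset)) fcm_gen p.1) = a /\
  diag_of (\sum_(p <- (s : {mset _}%mset)) fcm_gen p.2) = b.

Definition matching_cost (s : fcm (X * X)%type) : R :=
  \sum_(p <- (s : {mset _}%mset)) d1 p.1 p.2.

Definition W1 (a b : diag) : R :=
  inf [set matching_cost s | s in is_matching a b].

Definition vdiag := groth diag.
HB.instance Definition _ := GRing.Zmodule.on vdiag.

(* rho (a - b) (c - d) = W1 (a + d) (c + b): [repr x] is some pair (a, b) with
   x = a - b, and the value does not depend on that choice because W1 is
   translation invariant. *)
Definition rho (x y : vdiag) : R :=
  let a := repr (x : groth diag) in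
  let c := repr (y : groth diag) in
  W1 (a.1 + c.2) (c.1 + a.2).

End VirtualPersistenceDiagrams.

(* A Banach space over [scal R s] is a real or a complex Banach space. *)
Inductive scalars := RealScalars | ComplexScalars.

Definition scal (R : realType) (s : scalars) : numFieldType :=
  match s with RealScalars => R | ComplexScalars => complex R end.

Definition re (R : realType) (s : scalars) : scal R s -> R :=
  match s return scal R s -> R with
  | RealScalars => id
  | ComplexScalars => @complex.Re R
  end.

(* In a normed module over a field F, the norm takes its values in F. *)
Definition rnorm (R : realType) (s : scalars) (E : normedModType (scal R s))
  (v : E) : R := re `|v|.

Section RealNorm.
Variables (R : realType) (s : scalars) (E : normedModType (scal R s)).

Lemma re0 : re (0 : scal R s) = 0.
Proof. by case: s. Qed.

Lemma reD (x y : scal R s) : re (x + y) = re x + re y.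
Proof. by move: x y; case: s => // -[a b] [c d]. Qed.

Lemma le_re (x y : scal R s) : x <= y -> re x <= re y.
Proof.
by move: x y; case: s => //= -[a b] [c d]; rewrite lecE/= => /andP[].
Qed.

Lemma reM (x y : scal R s) : 0 <= x -> 0 <= y -> re (x * y) = re x * re y.
Proof.
move: x y; case: s => //= -[a b] [c d]; rewrite !lecE/=.
by move=> /andP[/eqP-> _] /andP[/eqP-> _]; rewrite mulr0 subr0.
Qed.

Lemma rnorm_ge0 (v : E) : 0 <= rnorm v.
Proof. by rewrite -re0 le_re. Qed.

Lemma rnorm0 : rnorm (0 : E) = 0.
Proof. by rewrite /rnorm normr0 re0. Qed.

Lemma ler_rnormD (u v : E) : rnorm (u + v) <= rnorm u + rnorm v.
Proof. by rewrite -reD le_re// ler_normD. Qed.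

Lemma rnormZ (a : scal R s) (v : E) : rnorm (a *: v) = re `|a| * rnorm v.
Proof. by rewrite /rnorm normrZ reM. Qed.

End RealNorm.

Section BoundedFunctions.
Variables (R : realType) (s : scalars) (T : Type).
Variable E : normedModType (scal R s).

Definition ellinf_pred : {pred (T -> E)} :=
  fun u => `[< has_ubound (range (fun x => rnorm (u x))) >].

Lemma ellinf_predP (u : T -> E) :
  reflect (exists M, forall x, rnorm (u x) <= M) (u \in ellinf_pred).
Proof.
apply: (iffP (asboolP _)) => -[M uM]; exists M.
- by move=> x; apply: uM; exists x.
- by move=> _ [x _ <-].
Qed.

Lemma ellinf_submod_closed : subsemimod_closed ellinf_pred.
Proof.
split; first split.
- by apply/ellinf_predP; exists 0 => x; rewrite rnorm0.
- move=> u v /ellinf_predP[M uM] /ellinf_predP[N vN].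
  apply/ellinf_predP; exists (M + N) => x.
  by rewrite (le_trans (ler_rnormD _ _))// lerD.
- move=> a u /ellinf_predP[M uM].
  apply/ellinf_predP; exists (re `|a| * M) => x.
  by rewrite rnormZ ler_wpM2l// -(@re0 R s) le_re.
Qed.
HB.instance Definition _ := GRing.isSubmodClosed.Build (scal R s) (T -> E)
  ellinf_pred ellinf_submod_closed.

Record ellinf := Ellinf {
  ellinf_fun :> T -> E ;
  ellinfP : ellinf_fun \in ellinf_pred
}.
HB.instance Definition _ := [isSub for ellinf_fun].
HB.instance Definition _ := [Choice of ellinf by <:].
HB.instance Definition _ := [SubChoice_isSubLmodule of ellinf by <:].

Definition supnorm (u : ellinf) : R := sup (range (fun x => rnorm (u x))).

Lemma rnorm_le_supnorm (u : ellinf) x : rnorm (u x) <= supnorm u.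
Proof.
have /ellinf_predP[M uM] := ellinfP u.
apply: ub_le_sup; last by exists x.
by exists M => _ [y _ <-].
Qed.

Lemma supnorm_ge0 (u : ellinf) : 0 <= supnorm u.
Proof.
have [S0|/set0P[_ [x _ _]]] := eqVneq (range (fun x => rnorm (u x))) set0.
  by rewrite /supnorm S0 sup0.
exact: le_trans (rnorm_ge0 _) (rnorm_le_supnorm u x).
Qed.

Lemma supnorm_le (u : ellinf) (M : R) :
  0 <= M -> (forall x, rnorm (u x) <= M) -> supnorm u <= M.
Proof.
move=> M0 uM; have [[x0 _]|T0] := pselect (exists x : T, True).
  by apply: sup_le_ub; [exists (rnorm (u x0)), x0|move=> _ [x _ <-]].
suff S0 : range (fun x => rnorm (u x)) = set0 by rewrite /supnorm S0 sup0.
by apply/seteqP; split => // v [x _ _]; apply: T0; exists x.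
Qed.

Lemma supnormD (u v : ellinf) : supnorm (u + v) <= supnorm u + supnorm v.
Proof.
apply: supnorm_le => [|x]; first by rewrite addr_ge0 ?supnorm_ge0.
by rewrite (le_trans (ler_rnormD _ _))// lerD ?rnorm_le_supnorm.
Qed.

Lemma supnormZ_le (a : scal R s) (u : ellinf) :
  supnorm (a *: u) <= re `|a| * supnorm u.
Proof.
have a0 : 0 <= re `|a| by rewrite -(@re0 R s) le_re.
apply: supnorm_le => [|x]; first by rewrite mulr_ge0 ?supnorm_ge0.
by rewrite rnormZ ler_wpM2l ?rnorm_le_supnorm.
Qed.

End BoundedFunctions.

Lemma setdist_ge0 (R : realType) (X : metricType R) (A : set X) x :
  0 <= setdist A x.
Proof.
rewrite /setdist; have [->|/set0P A0] := eqVneq A set0.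
  by rewrite image_set0 inf0.
apply: lb_le_inf; first by case: A0 => a aA; exists (mdist x a), a.
by move=> _ [a _ <-]; rewrite mdist_ge0.
Qed.

Lemma rho_ge0 (R : realType) (X : metricType R) (A : set X)
  (x y : vdiag A) : 0 <= rho x y.
Proof.
rewrite /rho /W1; set S := [set _ | _ in _].
have [->|/set0P S0] := eqVneq S set0; first by rewrite inf0.
apply: lb_le_inf => // _ [m _ <-].
apply: sumr_ge0 => p _.
by rewrite /d1 le_min mdist_ge0 addr_ge0 ?setdist_ge0.
Qed.

Section FunctionSpaces.
Variables (R : realType) (X : metricType R) (A : set X) (s : scalars).
Variable E : normedModType (scal R s).
Local Notation G := (vdiag A).

Definition translate (k : G) (u : G -> E) : G -> E := fun x => u (x + k).

Lemma translate_ellinf (k : G) (u : ellinf G E) :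
  translate k u \in ellinf_pred (E := E).
Proof.
have /ellinf_predP[M uM] := ellinfP u.
by apply/ellinf_predP; exists M => x; exact: uM.
Qed.

Definition tau (k : G) (u : ellinf G E) : ellinf G E :=
  Ellinf (translate_ellinf k u).

(* The suprema below are taken in R, where the supremum of the empty set is 0:
   both norms vanish when K(X, A) is trivial. *)
Definition lip_quotients (f : G -> E) : set R :=
  [set rnorm (f p.1 - f p.2) / rho p.1 p.2
  | p in [set p : G * G | p.1 != p.2]].

Definition lip_pred : {pred (G -> E)} :=
  fun f => `[< has_ubound (lip_quotients f) >].

Lemma lip_predP (f : G -> E) :
  reflect (exists M, forall x y, x != y -> rnorm (f x - f y) / rho x y <= M)
          (f \in lip_pred).
Proof.
apply: (iffP (asboolP _)) => -[M fM]; exists M.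
- by move=> x y xy; apply: fM; exists (x, y).
- by move=> _ [p pP <-]; exact: fM.
Qed.

Lemma lip_submod_closed : subsemimod_closed lip_pred.
Proof.
split; first split.
- by apply/lip_predP; exists 0 => x y _; rewrite subrr rnorm0 mul0r.
- move=> f g /lip_predP[M fM] /lip_predP[N gN].
  apply/lip_predP; exists (M + N) => x y xy.
  rewrite (le_trans _ (lerD (fM _ _ xy) (gN _ _ xy)))// -mulrDl.
  rewrite ler_wpM2r ?invr_ge0 ?rho_ge0//.
  by rewrite (le_trans _ (ler_rnormD _ _))//= addrACA opprD.
- move=> a f /lip_predP[M fM].
  apply/lip_predP; exists (re `|a| * M) => x y xy.
  have -> : (a *: f) x - (a *: f) y = a *: (f x - f y) by rewrite scalerBr.
  by rewrite rnormZ -mulrA ler_wpM2l ?fM// -(@re0 R s) le_re.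
Qed.
HB.instance Definition _ := GRing.isSubmodClosed.Build (scal R s) (G -> E)
  lip_pred lip_submod_closed.

Record lip := Lip { lip_fun :> G -> E ; lipP : lip_fun \in lip_pred }.
HB.instance Definition _ := [isSub for lip_fun].
HB.instance Definition _ := [Choice of lip by <:].
HB.instance Definition _ := [SubChoice_isSubLmodule of lip by <:].

Definition lipnorm (f : lip) : R := sup (lip_quotients f).

Definition constants : {pred lip} :=
  fun f => `[< exists e : E, forall x, f x = e >].

Lemma constants_submod_closed : subsemimod_closed constants.
Proof.
split; first split.
- by apply/asboolP; exists 0.
- move=> f g /asboolP[e fe] /asboolP[e' ge]; apply/asboolP; exists (e + e').
  by move=> x; rewrite -(fe x) -(ge x).
- move=> a f /asboolP[e fe]; apply/asboolP; exists (a *: e).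
  by move=> x; rewrite -(fe x).
Qed.
HB.instance Definition _ := GRing.isSubmodClosed.Build (scal R s) lip
  constants constants_submod_closed.

Definition lipmod := lmquot constants.
HB.instance Definition _ := GRing.Lmodule.on lipmod.

Definition lip_class (f : lip) : lipmod := \pi_(lmquot constants) f.

Definition lipmod_norm (q : lipmod) : R :=
  lipnorm (repr (q : lmquot constants)).

(* Lip(f) only depends on f modulo constants. *)
Lemma lipmod_normE (f : lip) : lipmod_norm (lip_class f) = lipnorm f.
Proof.
rewrite /lipmod_norm /lip_class /lipnorm; congr sup.
have /eqP := reprK (\pi_(lmquot constants) f).
rewrite piE Quotient.equivE => /asboolP[e fe].
have {}fe x : repr (\pi_(lmquot constants) f) x = e + f x.
  by rewrite -(fe x) /= subrK.
apply: eq_imagel => -[x y] _ /=.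
by rewrite !fe opprD addrACA subrr add0r.
Qed.

Definition Z1_quotients (b : G -> ellinf G E) : set R :=
  [set supnorm (b h) / rho h 0 | h in [set h : G | h != 0]].

Definition Z1_pred : {pred (G -> ellinf G E)} :=
  fun b => `[< (forall h k, b (h + k) = tau k (b h) + b k) /\
               has_ubound (Z1_quotients b) >].

Lemma tauD k (u v : ellinf G E) : tau k (u + v) = tau k u + tau k v.
Proof. exact: val_inj. Qed.

Lemma tauZ k a (u : ellinf G E) : tau k (a *: u) = a *: tau k u.
Proof. exact: val_inj. Qed.

Lemma Z1_predP (b : G -> ellinf G E) :
  reflect ((forall h k, b (h + k) = tau k (b h) + b k) /\
           exists M, forall h, h != 0 -> supnorm (b h) / rho h 0 <= M)
          (b \in Z1_pred).
Proof.
apply: (iffP (asboolP _)) => -[bC [M bM]]; split=> //; exists M.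
- by move=> h h0; apply: bM; exists h.
- by move=> _ [h h0 <-]; exact: bM.
Qed.

Lemma Z1_submod_closed : subsemimod_closed Z1_pred.
Proof.
split; first split.
- apply/Z1_predP; split => [h k|]; first by apply/val_inj/esym/addr0.
  exists 0 => h _; rewrite mulr_le0_ge0 ?invr_ge0 ?rho_ge0//.
  by apply: supnorm_le => // x; rewrite rnorm0.
- move=> b c /Z1_predP[bC [M bM]] /Z1_predP[cC [N cN]]; apply/Z1_predP.
  split=> [h k|].
    rewrite -[LHS]/(b (h + k) + c (h + k)) bC cC addrACA.
    by rewrite -tauD.
  exists (M + N) => h h0.
  rewrite (le_trans _ (lerD (bM _ h0) (cN _ h0)))// -mulrDl.
  by rewrite ler_wpM2r ?invr_ge0 ?rho_ge0//; exact: supnormD.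
- move=> a b /Z1_predP[bC [M bM]]; apply/Z1_predP; split=> [h k|].
    by rewrite -[LHS]/(a *: b (h + k)) bC scalerDr -tauZ.
  have a0 : 0 <= re `|a| by rewrite -(@re0 R s) le_re.
  exists (re `|a| * M) => h h0.
  rewrite (le_trans _ (ler_wpM2l a0 (bM _ h0)))// mulrA.
  by rewrite ler_wpM2r ?invr_ge0 ?rho_ge0//; exact: supnormZ_le.
Qed.
HB.instance Definition _ := GRing.isSubmodClosed.Build (scal R s)
  (G -> ellinf G E) Z1_pred Z1_submod_closed.

Record Z1 := MkZ1 { Z1_fun :> G -> ellinf G E ; Z1P : Z1_fun \in Z1_pred }.
HB.instance Definition _ := [isSub for Z1_fun].
HB.instance Definition _ := [Choice of Z1 by <:].
HB.instance Definition _ := [SubChoice_isSubLmodule of Z1 by <:].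

Definition Z1norm (b : Z1) : R := sup (Z1_quotients b).

Definition Delta (f : G -> E) (h : G) : G -> E := fun x => f (x + h) - f x.

End FunctionSpaces.

Arguments lip {R X} A {s} E.
Arguments lipmod {R X} A {s} E.
Arguments Z1 {R X} A {s} E.

(* Main.v *)
From HB Require Import structures.
Require Import Defs.
From mathcomp Require Import all_boot all_order all_algebra.
From mathcomp Require Import generic_quotient finmap multiset lra.
From mathcomp Require Import all_classical all_reals all_analysis.

Import Order.TTheory GRing.Theory Num.Theory.
Import numFieldNormedType.Exports.

Local Open Scope classical_set_scope.
Local Open Scope ring_scope.
Local Open Scope quotient_scope.

(** The map sends f to its coboundary (Delta_h f)_h, and everything rests on
    two facts about the metric rho of K(X, A): it is translation invariant,
    rho x y = rho (x - y) 0, and it separates points.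

    Given these, |f (x + h) - f x| <= Lip f * rho h 0, so each Delta_h f is
    bounded and the coboundary is a cocycle of norm at most Lip f. Its kernel
    consists of the constants. Conversely a cocycle b is the coboundary of
    x |-> b_x(0): the cocycle identity gives b_(x+h)(0) - b_x(0) = b_h(x)
    (coboundary_primitive). The two norms agree because
    f x - f y = (Delta_(x-y) f)(y), so a bound on either family of quotients
    bounds the other (Z1norm_coboundary).

    Translation invariance reduces to W1 (a + c) (b + c) = W1 a b
    (W1_translation). It suffices to cancel one point x outside A: a matching
    of a + x with b + x contains pairs (x, v) and (u, x), and replacing them by
    (u, v) does not raise the cost, by the triangle inequality for d1
    (matches_splice). Separation holds because diagrams are finite and A is
    closed: d1 takes finitely many values on the supports of two diagrams and
    on A, hence a matching cheap enough can only pair equal points of X / A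
    (W1_eq0). Separation matters because division by zero yields zero: without
    it, bounded quotients would not bound f x - f y where rho x y = 0. *)

(** * Diagrams as sums of points *)

Section Diagrams.
Context {R : realType} {X : metricType R} {A : set X}.
Implicit Types (x y : X) (m n : fcm X) (a b c : diag A) (l : seq (X * X)).

Definition diag_pt x : diag A := diag_of A (fcm_gen x).

Lemma diag_of_eq m n :
  diag_of A m = diag_of A n <->
  exists p q, [/\ p \in fcm_on A, q \in fcm_on A & m + p = n + q].
Proof.
rewrite /diag_of; split.
  by move=> /eqP; rewrite piE => /asboolP.
by move=> pq; apply/eqP; rewrite piE; apply/asboolP.
Qed.

Lemma diag_of0 : diag_of A 0 = 0.
Proof. by rewrite /diag_of piE. Qed.

Lemma diag_ofD m n : diag_of A (m + n) = diag_of A m + diag_of A n.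
Proof. exact: pi_mquotD. Qed.

Lemma diag_of_sum (I : Type) (r : seq I) (F : I -> fcm X) :
  diag_of A (\sum_(i <- r) F i) = \sum_(i <- r) diag_of A (F i).
Proof. exact: (big_morph _ diag_ofD diag_of0). Qed.

Lemma fcmDE m n x : ((m + n : fcm X) : {mset X}%mset) x = (m x + n x)%N.
Proof. by rewrite -[(m + n : fcm X)]/(msetD m n) msetE2. Qed.

Lemma fcm_addIr n : injective (fun m => m + n).
Proof.
move=> m m' /= e; apply/msetP => x.
by apply: (@addIn (n x)); rewrite -!fcmDE e.
Qed.

Lemma diag_of_surj a : exists m, a = diag_of A m.
Proof. by exists (repr (a : mquot (@fcm_on X A))); rewrite /diag_of reprK. Qed.

Lemma diag_addIr c : injective (fun a => a + c).
Proof.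
move=> a b /=.
have [m ->] := diag_of_surj a; have [n ->] := diag_of_surj b.
have [k ->] := diag_of_surj c.
rewrite -!diag_ofD => /diag_of_eq[p [q [pA qA e]]]; apply/diag_of_eq.
exists p, q; split=> //; apply: (@fcm_addIr k).
by rewrite /= addrAC e addrAC.
Qed.

Lemma fcm_on0 m x : m \in fcm_on A -> ~ A x -> m x = 0%N.
Proof.
move=> /allP mA Ax; apply/eqP; rewrite mset_eq0; apply/negP => /mA.
by rewrite inE.
Qed.

Lemma sum_fcm_genE (s : seq X) x :
  (\sum_(y <- s) fcm_gen y : fcm X) x = count_mem x s.
Proof.
elim: s => [|y s IH]; first by rewrite big_nil; exact: mset0E.
by rewrite big_cons fcmDE IH /= /fcm_gen msetnE (eq_sym x); case: eqP.
Qed.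

Lemma fcm_sum m : m = \sum_(x <- (m : {mset X}%mset)) fcm_gen x.
Proof.
apply/msetP => x.
by rewrite sum_fcm_genE count_mem_mset.
Qed.

Lemma diag_sum a : exists s : seq X, a = \sum_(x <- s) diag_pt x.
Proof.
have [m ->] := diag_of_surj a; exists (enum_mset m).
by rewrite [in LHS](fcm_sum m) diag_of_sum.
Qed.

Lemma diag_pt_eq0 x : A x -> diag_pt x = 0.
Proof.
move=> Ax; rewrite -diag_of0; apply/diag_of_eq; exists 0, (fcm_gen x).
split; [exact: rpred0| |by rewrite addrC].
by apply/allP => y; rewrite in_mset1 => /eqP->; rewrite inE.
Qed.

(** Multiplicities at points outside A survive in D(X) / D(A), since elements
    of D(A) have none there. *)
Lemma mem_diag_sum x (s : seq X) c :
  ~ A x -> \sum_(y <- s) diag_pt y = diag_pt x + c -> x \in s.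
Proof.
move=> Ax; have [m ->] := diag_of_surj c.
rewrite -diag_of_sum -diag_ofD => /diag_of_eq[p [q [pA qA]]].
move=> /(congr1 (fun k : fcm X => k x)).
rewrite !fcmDE (fcm_on0 _ _ pA Ax) (fcm_on0 _ _ qA Ax) !addn0.
by rewrite sum_fcm_genE /fcm_gen msetnxx => e; rewrite -has_pred1 has_count e.
Qed.

(** * Matchings and the distance W1 *)

(** A list of pairs standing for a multiset of pairs: lists are easier to cut
    and splice. *)
Definition matches a b l :=
  \sum_(p <- l) diag_pt p.1 = a /\ \sum_(p <- l) diag_pt p.2 = b.

Definition cost l := \sum_(p <- l) d1 A p.1 p.2.

Lemma W1E a b : W1 a b = inf [set cost l | l in matches a b].
Proof.
rewrite /W1; congr inf; apply/seteqP; split => _ [l [l1 l2] <-].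
  by exists (enum_mset l) => //; split; rewrite -diag_of_sum.
exists (seq_mset l); last first.
  exact: perm_big (perm_eq_seq_mset l).
by split; rewrite diag_of_sum (perm_big _ (perm_eq_seq_mset l)).
Qed.

Lemma d1_ge0 x y : 0 <= d1 A x y.
Proof. by rewrite /d1 le_min mdist_ge0 addr_ge0 ?setdist_ge0. Qed.

Lemma cost_ge0 l : 0 <= cost l.
Proof. by apply: sumr_ge0 => p _; exact: d1_ge0. Qed.

Lemma W1_le a b l : matches a b l -> W1 a b <= cost l.
Proof.
move=> abl; rewrite W1E; apply: ge_inf; last by exists l.
by exists 0 => _ [k _ <-]; exact: cost_ge0.
Qed.

Hypothesis A0 : A !=set0.

(** Sending every point of both diagrams to a point of A is a matching; without
    one, W1 would be the infimum of the empty set. *)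
Lemma matches_ex a b : exists l, matches a b l.
Proof.
have [z Az] := A0; have [s ->] := diag_sum a; have [t ->] := diag_sum b.
exists ([seq (x, z) | x <- s] ++ [seq (z, y) | y <- t]).
split; rewrite big_cat !big_map /=.
  by rewrite [X in _ + X]big1 ?addr0// => i _; exact: diag_pt_eq0.
by rewrite [X in X + _]big1 ?add0r// => i _; exact: diag_pt_eq0.
Qed.

Lemma le_W1 a b (r : R) :
  (forall l, matches a b l -> r <= cost l) -> r <= W1 a b.
Proof.
move=> h; rewrite W1E; apply: lb_le_inf => [|_ [l abl <-]]; last exact: h.
by have [l abl] := matches_ex a b; exists (cost l), l.
Qed.

Lemma setdist_le x z : A z -> setdist A x <= mdist x z.
Proof.
move=> Az; apply: ge_inf; last by exists z.
by exists 0 => _ [w _ <-]; exact: mdist_ge0.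
Qed.

Lemma setdist_lip x y : setdist A x <= mdist x y + setdist A y.
Proof.
rewrite -lerBlDl; apply: lb_le_inf.
  by have [z Az] := A0; exists (mdist y z), z.
move=> _ [z Az <-]; rewrite lerBlDl.
exact: le_trans (setdist_le x z Az) (metric_triangle _ _ _).
Qed.

(** When both distances on the right run through A, the left side is at most
    setdist x + setdist z; when exactly one does, setdist is 1-Lipschitz. *)
Lemma d1_triangle y x z : d1 A x z <= d1 A x y + d1 A y z.
Proof.
have := metric_triangle x y z; have := setdist_lip x y.
have := setdist_lip z y; have := setdist_ge0 A y.
rewrite (metric_sym z y) /d1 => h1 h2 h3 h4; rewrite ge_min.
have [d_xy|d_xy] := leP (mdist x y); have [d_yz|d_yz] := leP (mdist y z).
- by apply/orP; left.
- apply/orP; right; lra.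
- apply/orP; right; lra.
- apply/orP; right; lra.
Qed.

Lemma d1xx x : d1 A x x = 0.
Proof.
by apply/eqP; rewrite eq_le d1_ge0 andbT /d1 ge_min mdistxx lexx.
Qed.

(** The pairs (x, v) and (u, x) that must occur are replaced by (u, v), unless
    they are one and the same pair (x, x), which is dropped. *)
Lemma matches_splice x a b l :
  ~ A x -> matches (a + diag_pt x) (b + diag_pt x) l ->
  exists2 k, matches a b k & cost k <= cost l.
Proof.
move=> Ax [l1 l2].
have : x \in [seq p.1 | p <- l].
  by apply: (mem_diag_sum x _ a Ax); rewrite big_map l1 addrC.
case/mapP => -[x' v] xvl /= ?; subst x'.
have P := perm_to_rem xvl; move: (rem _ _) P => l' P.
move: l1 l2; rewrite !(perm_big _ P) !big_cons /= => l1 l2.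
have {}l1 : \sum_(p <- l') diag_pt p.1 = a.
  by apply: (@diag_addIr (diag_pt x)); rewrite /= -l1 addrC.
have -> : cost l = d1 A x v + cost l' by rewrite /cost (perm_big _ P) big_cons.
have [vx|vx] := eqVneq v x.
  subst v; exists l'; last by rewrite d1xx add0r.
  by split=> //; apply: (@diag_addIr (diag_pt x)); rewrite /= -l2 addrC.
have : x \in v :: [seq p.2 | p <- l'].
  by apply: (mem_diag_sum x _ b Ax); rewrite big_cons big_map l2 addrC.
rewrite inE eq_sym (negbTE vx) /=; case/mapP => -[u x'] uxl' /= ?; subst x'.
have Q := perm_to_rem uxl'; move: (rem _ _) Q => k Q.
move: l1 l2; rewrite !(perm_big _ Q) !big_cons /= => l1 l2.
exists ((u, v) :: k); last first.
  rewrite /cost (perm_big _ Q) !big_cons /= addrA lerD2r addrC.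
  exact: d1_triangle.
split; rewrite big_cons //=; apply: (@diag_addIr (diag_pt x)).
by rewrite /= -l2 -addrA (addrC (diag_pt x)).
Qed.

Lemma W1_translation a b c : W1 (a + c) (b + c) = W1 a b.
Proof.
have [s ->] := diag_sum c; elim: s a b {c} => [|x s IH] a b.
  by rewrite big_nil !addr0.
rewrite big_cons !addrA IH; have [Ax|Ax] := pselect (A x).
  by rewrite diag_pt_eq0 ?addr0.
apply/eqP; rewrite eq_le; apply/andP; split; apply: le_W1 => l.
  move=> [l1 l2]; have -> : cost l = cost ((x, x) :: l).
    by rewrite /cost big_cons d1xx add0r.
  by apply: W1_le; split; rewrite big_cons /= ?l1 ?l2 addrC.
by move=> /matches_splice => /(_ Ax)[k /W1_le]; exact: le_trans.
Qed.

Hypothesis Acl : closed A.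

Lemma setdist_gt0 x : ~ A x -> 0 < setdist A x.
Proof.
move=> Ax; have : nbhs x (~` A).
  by apply: open_nbhs_nbhs; split => //; rewrite openC.
move=> /nbhs_ballP[e /= e0]; rewrite ballEmdist => eA.
apply: lt_le_trans e0 _; apply: lb_le_inf.
  by have [z Az] := A0; exists (mdist x z), z.
by move=> _ [z Az <-]; rewrite leNgt; apply/negP => /eA.
Qed.

Lemma d1_gt0 x y : x != y -> ~ A x \/ ~ A y -> 0 < d1 A x y.
Proof.
move=> xy Axy; rewrite /d1 lt_min mdist_gt0 xy /=.
case: Axy => /setdist_gt0 h.
  by rewrite ltr_wpDr ?setdist_ge0.
by rewrite ltr_wpDl ?setdist_ge0.
Qed.

Lemma setdist0 x : A x -> setdist A x = 0.
Proof.
move=> Ax; apply/eqP; rewrite eq_le setdist_ge0 andbT -(mdistxx x).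
exact: setdist_le.
Qed.

(** d1 only sees points of A through their common class in X / A. *)
Lemma d1_on x y z : A x -> A z -> d1 A x y = d1 A z y.
Proof.
move=> Ax Az; rewrite /d1 (setdist0 x)// (setdist0 z)// !add0r.
have sx w : A w -> setdist A y <= mdist w y.
  by move=> Aw; rewrite metric_sym setdist_le.
by rewrite !min_r ?sx.
Qed.

Lemma d1_sym x y : d1 A x y = d1 A y x.
Proof. by rewrite /d1 metric_sym [setdist A x + _]addrC. Qed.

Lemma pos_lower_bound (I : eqType) (r : seq I) (f : I -> R) :
  {in r, forall i, 0 < f i} -> exists2 e, 0 < e & {in r, forall i, e <= f i}.
Proof.
elim: r => [_|i r IH fr]; first by exists 1.
have [|e e0 er] := IH; first by move=> j jr; apply: fr; rewrite inE jr orbT.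
exists (Num.min e (f i)); first by rewrite lt_min e0 fr ?mem_head.
move=> j; rewrite inE => /orP[/eqP->|/er ej]; first by rewrite ge_min lexx orbT.
by rewrite ge_min ej.
Qed.

Lemma mem_matched a (s : seq X) (I : eqType) (l : seq I) (f : I -> X) i :
  \sum_(x <- s) diag_pt x = a -> \sum_(i <- l) diag_pt (f i) = a ->
  i \in l -> ~ A (f i) -> f i \in s.
Proof.
move=> sa la il Afi; apply: (mem_diag_sum _ _ _ Afi); rewrite sa -la.
exact: big_rem il.
Qed.

(** Let e be a positive lower bound of the finitely many nonzero values of d1 on
    the supports of a and b and one point z of A. Every pair of a matching has,
    up to moving points of A to z, both ends in that finite set; if the matching
    costs less than e, each of its pairs joins two points with the same class,
    so a = b. *)
Lemma W1_eq0 a b : W1 a b = 0 -> a = b.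
Proof.
have [z Az] := A0; have [s sa] := diag_sum a; have [t tb] := diag_sum b.
pose L := z :: s ++ t.
have [e e0 eL] : exists2 e : R, 0 < e & forall x y, x \in L -> y \in L ->
    x != y -> ~ A x \/ ~ A y -> e <= d1 A x y.
  pose r := [seq p <- [seq (x, y) | x <- L, y <- L] |
              (p.1 != p.2) && `[< ~ A p.1 \/ ~ A p.2 >]].
  have [[x y]|e e0 er] := @pos_lower_bound _ r (fun p => d1 A p.1 p.2).
    by rewrite mem_filter => /andP[/andP[xy /asboolP]] /(d1_gt0 _ _ xy).
  exists e => // x y xL yL xy Axy; apply: (er (x, y)).
  rewrite mem_filter /= xy; apply/andP; split; first exact/asboolP.
  exact: (allpairs_f pair xL yL).
move=> W0.
have [[l abl le]|h] := pselect (exists2 l, matches a b l & cost l < e);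
  last first.
  suff : e <= W1 a b by rewrite W0 leNgt e0.
  by apply: le_W1 => l abl; rewrite leNgt; apply/negP => le; apply: h; exists l.
suff h p : p \in l -> diag_pt p.1 = diag_pt p.2.
  by have [<- <-] := abl; apply: eq_big_seq => p; exact: h.
move=> pl.
have pe : d1 A p.1 p.2 < e.
  apply: le_lt_trans le; rewrite /cost (big_rem p pl) lerDl.
  exact: cost_ge0.
have rep x : (~ A x -> x \in s ++ t) -> exists y,
    [/\ y \in L, diag_pt y = diag_pt x & forall w, d1 A y w = d1 A x w].
  have [Ax _|Ax /(_ Ax) xst] := pselect (A x).
    by exists z; rewrite inE eqxx !diag_pt_eq0//; split=> // w; exact: d1_on.
  by exists x; rewrite inE xst orbT.
case: abl => la lb.
have [|x [xL <- dx]] := rep p.1.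
  by move=> Ap; rewrite mem_cat (mem_matched a s _ l fst p).
have [|y [yL <- dy]] := rep p.2.
  by move=> Ap; rewrite mem_cat (mem_matched b t _ l snd p) ?orbT.
move: pe; rewrite -dx d1_sym -dy d1_sym => xye.
have [->//|xy] := eqVneq x y.
have [[Ax Ay]|Axy] := pselect (A x /\ A y); first by rewrite !diag_pt_eq0.
move: xye; rewrite ltNge => /negP[]; apply: eL => //.
exact/not_andP.
Qed.

(** * The metric rho *)

(** The value of rho may be read off any representatives: if p' and q' represent
    the same elements, adding suitable diagrams to both arguments of W1 turns
    one expression into the other. *)
Lemma rhoE (p q : diag A * diag A) :
  rho (\pi_(groth (diag A)) p : vdiag A) (\pi_(groth (diag A)) q) =
  W1 (p.1 + q.2) (q.1 + p.2).
Proof.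
rewrite /rho.
have /eqP := reprK (\pi_(groth (diag A)) p); rewrite piE => /asboolP[k].
have /eqP := reprK (\pi_(groth (diag A)) q); rewrite piE => /asboolP[l].
set q' := repr _; set p' := repr _ => eq ep.
rewrite -(W1_translation _ _ (p.2 + q.1 + (k + l))).
rewrite -[RHS](W1_translation _ _ (p'.2 + q'.1 + (k + l))).
congr W1; last by rewrite (AC (2*(2*1)) ((4*3)*(2*1*5)))/=.
rewrite (AC (2*(2*2)) ((1*3*5)*(4*2*6)))/=.
rewrite [RHS](AC (2*(2*2)) ((1*3*5)*(4*2*6)))/=.
by rewrite ep eq.
Qed.

Lemma vdiag_surj (x : vdiag A) :
  exists p, x = \pi_(groth (diag A)) p.
Proof. by exists (repr (x : groth (diag A))); rewrite reprK. Qed.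

Lemma rhoB (x y : vdiag A) : rho x y = rho (x - y) 0.
Proof.
have [p ->] := vdiag_surj x; have [q ->] := vdiag_surj y.
have -> : (\pi_(groth (diag A)) p - \pi_(groth (diag A)) q : vdiag A) =
    \pi_(groth (diag A)) (p + (q.2, q.1)).
  by rewrite pi_grothD (pi_groth_opp q).
have -> : (0 : vdiag A) = \pi_(groth (diag A)) 0 by rewrite piE.
by rewrite !rhoE /= addr0 add0r (addrC q.1).
Qed.

Lemma rho_gt0 (x y : vdiag A) : x != y -> 0 < rho x y.
Proof.
move=> xy; rewrite lt_neqAle rho_ge0 andbT eq_sym; apply: contra_neq xy.
have [p ->] := vdiag_surj x; have [q ->] := vdiag_surj y.
rewrite rhoE => /W1_eq0 e; apply/eqP; rewrite piE; apply/asboolP.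
by exists 0; rewrite e.
Qed.

Lemma rho_xx (x : vdiag A) : rho x x = 0.
Proof.
rewrite rhoB subrr.
have -> : (0 : vdiag A) = \pi_(groth (diag A)) 0 by rewrite piE.
rewrite rhoE; apply/eqP; rewrite eq_le.
have M : matches (0 + 0) (0 + 0) [::] by rewrite /matches !big_nil addr0.
rewrite (le_trans (W1_le _ _ _ M)) /cost ?big_nil//=.
by apply: le_W1 => l _; exact: cost_ge0.
Qed.

End Diagrams.

(** * Lipschitz functions and cocycles *)

Section Cocycles.
Context {R : realType} {X : metricType R} {A : set X}.
Hypotheses (A0 : A !=set0) (Acl : closed A).
Context {s : scalars} {E : normedModType (scal R s)}.
Local Notation K := (vdiag A).
Implicit Types (f g : lip A E) (b : Z1 A E) (h k x y : K).

Lemma lip_le f x y : rnorm (f x - f y) <= lipnorm f * rho x y.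
Proof.
have [->|xy] := eqVneq x y; first by rewrite subrr rnorm0 rho_xx// mulr0.
rewrite -ler_pdivrMr ?rho_gt0//; apply: ub_le_sup; last by exists (x, y).
exact/asboolP/(lipP f).
Qed.

Lemma lipnorm_ge0 f : 0 <= lipnorm f.
Proof.
have [[p pP]|h] := pselect (exists p : K * K, p.1 != p.2); last first.
  rewrite /lipnorm (_ : lip_quotients _ = set0) ?sup0//.
  by apply/seteqP; split => // r [p pP _]; apply: h; exists p.
apply: le_trans (_ : rnorm (f p.1 - f p.2) / rho p.1 p.2 <= _).
  by rewrite divr_ge0 ?rnorm_ge0 ?rho_ge0.
by apply: ub_le_sup; [exact/asboolP/(lipP f)|exists p].
Qed.

Lemma lipnorm_le f (M : R) : 0 <= M ->
  (forall x y, rnorm (f x - f y) <= M * rho x y) -> lipnorm f <= M.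
Proof.
move=> M0 fM; have [S0|/set0P S0] := eqVneq (lip_quotients f) set0.
  by rewrite /lipnorm S0 sup0.
apply: ge_sup => // _ [[x y] /= xy <-].
by rewrite ler_pdivrMr ?rho_gt0.
Qed.

Lemma Z1_cocycle b h k x : b (h + k) x = b h (x + k) + b k x.
Proof. by have /Z1_predP[-> _] := Z1P b. Qed.

Lemma Z1_0 b x : b 0 x = 0.
Proof.
by apply: (addIr (b 0 x)); have := Z1_cocycle b 0 0 x; rewrite !addr0 add0r.
Qed.

Lemma Z1_le b h : supnorm (b h) <= Z1norm b * rho h 0.
Proof.
have /Z1_predP[_ [M bM]] := Z1P b.
have [->|h0] := eqVneq h 0.
  by rewrite rho_xx// mulr0; apply: supnorm_le => // x; rewrite Z1_0 rnorm0.
rewrite -ler_pdivrMr ?rho_gt0//; apply: ub_le_sup; last by exists h.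
by exists M => _ [k k0 <-]; exact: bM.
Qed.

Lemma Z1norm_ge0 b : 0 <= Z1norm b.
Proof.
have /Z1_predP[_ [M bM]] := Z1P b.
have [[h h0]|h] := pselect (exists h, h != 0); last first.
  rewrite /Z1norm (_ : Z1_quotients _ = set0) ?sup0//.
  by apply/seteqP; split => // r [k kP _]; apply: h; exists k.
apply: le_trans (_ : supnorm (b h) / rho h 0 <= _).
  by rewrite divr_ge0 ?supnorm_ge0 ?rho_ge0.
apply: ub_le_sup; last by exists h.
by exists M => _ [k k0 <-]; exact: bM.
Qed.

Lemma Z1norm_le b (M : R) : 0 <= M ->
  (forall h, supnorm (b h) <= M * rho h 0) -> Z1norm b <= M.
Proof.
move=> M0 bM; have [S0|/set0P S0] := eqVneq (Z1_quotients b) set0.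
  by rewrite /Z1norm S0 sup0.
by apply: ge_sup => // _ [h /= h0 <-]; rewrite ler_pdivrMr ?rho_gt0.
Qed.

(** Translation invariance makes the bound uniform in x. *)
Lemma Delta_le f h x : rnorm (Delta f h x) <= lipnorm f * rho h 0.
Proof.
by apply: le_trans (lip_le _ _ _) _; rewrite rhoB// [x + h]addrC addrK.
Qed.

Lemma Delta_ellinf f h : Delta f h \in ellinf_pred (E := E).
Proof. by apply/ellinf_predP; eexists => x; exact: Delta_le. Qed.

Definition coboundary f h : ellinf K E := Ellinf (Delta_ellinf f h).

Lemma coboundary_Z1 f : coboundary f \in Z1_pred (E := E).
Proof.
apply/Z1_predP; split=> [h k|].
  apply/val_inj/funext => x /=.
  by rewrite -[RHS]/((f (x + k + h) - f (x + k)) + (f (x + k) - f x))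
    addrA subrK /Delta [h + k]addrC addrA.
exists (lipnorm f) => h h0; rewrite ler_pdivrMr ?rho_gt0//.
apply: supnorm_le => [|x]; last exact: Delta_le.
by rewrite mulr_ge0 ?lipnorm_ge0 ?rho_ge0.
Qed.

Definition coboundary_cocycle f : Z1 A E := MkZ1 (coboundary_Z1 f).

Lemma Z1_ext (b c : Z1 A E) : (forall h x, b h x = c h x) -> b = c.
Proof.
by move=> bc; apply/val_inj/funext => h; apply/val_inj/funext => x; exact: bc.
Qed.

(** A function whose differences all vanish is constant; this gives both the
    descent to the quotient and injectivity. *)
Lemma coboundary_eq f g :
  lip_class f = lip_class g <-> coboundary_cocycle f = coboundary_cocycle g.
Proof.
split.
  move=> /eqP; rewrite piE Quotient.equivE => /asboolP[e fge].
  apply: Z1_ext => h x /=.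
  have fg y : f y = e + g y by rewrite -(fge y) /= subrK.
  by rewrite /Delta !fg opprD addrACA subrr add0r.
move=> fg; apply/eqP; rewrite piE Quotient.equivE; apply/asboolP.
exists (f 0 - g 0) => x.
have := congr1 (fun b : Z1 A E => b x 0) fg.
rewrite /= /Delta !add0r => e; rewrite -[LHS]/(f x - g x).
by rewrite -(subrK (f 0) (f x)) e addrAC [g x - _]addrC addrK addrC.
Qed.

(** The values (Delta_(x-y) f)(y) are exactly the differences f x - f y. *)
Lemma Z1norm_coboundary f : Z1norm (coboundary_cocycle f) = lipnorm f.
Proof.
apply/eqP; rewrite eq_le; apply/andP; split.
  apply: Z1norm_le => [|h]; first exact: lipnorm_ge0.
  apply: supnorm_le => [|x]; last exact: Delta_le.
  by rewrite mulr_ge0 ?lipnorm_ge0 ?rho_ge0.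
apply: lipnorm_le => [|x y]; first exact: Z1norm_ge0.
rewrite rhoB//; apply: le_trans (Z1_le _ _).
have := rnorm_le_supnorm (coboundary_cocycle f (x - y)) y.
by rewrite /= /Delta [y + _]addrC subrK.
Qed.

(** By the cocycle identity b_x(0) - b_y(0) = b_(x-y)(y), which is at most
    the sup norm of b_(x-y). *)
Lemma primitive_lip b : (fun x => b x 0) \in lip_pred (E := E).
Proof.
apply/lip_predP; exists (Z1norm b) => x y xy; rewrite ler_pdivrMr ?rho_gt0//.
rewrite rhoB//; apply: le_trans (Z1_le _ _).
apply: le_trans (rnorm_le_supnorm _ y).
by rewrite -[in b x 0](subrK y x) Z1_cocycle add0r addrK.
Qed.

Lemma coboundary_primitive b : coboundary_cocycle (Lip (primitive_lip b)) = b.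
Proof.
apply: Z1_ext => h x /=.
by rewrite /Delta /= [x + h]addrC Z1_cocycle add0r addrK.
Qed.

End Cocycles.

Theorem theorem1p1 (R : realType) (X : metricType R) (A : set X)
    (A0 : A !=set0) (Acl : closed A)
    (s : scalars) (E : completeNormedModType (scal R s)) :
  exists Phi : {linear lipmod A E -> Z1 A E},
    [/\ forall (f : lip A E) (h x : vdiag A),
          Phi (lip_class f) h x = Delta f h x,
        bijective Phi
      & forall q : lipmod A E, Z1norm (Phi q) = lipmod_norm q].
Proof.
pose cob := coboundary_cocycle A0 Acl (E := E).
pose Phi (q : lipmod A E) : Z1 A E :=
  cob (repr (q : lmquot (@constants R X A s E))).
have PhiE f : Phi (lip_class f) = cob f.
  by apply/coboundary_eq; rewrite /lip_class reprK.
have surj (q : lipmod A E) : exists f, q = lip_class f.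
  exists (repr (q : lmquot (@constants R X A s E))).
  by rewrite /lip_class reprK.
have lin : linear Phi.
  move=> a q r; have [f ->] := surj q; have [g ->] := surj r.
  rewrite [X in Phi X](_ : _ = lip_class (a *: f + g)).
    rewrite !PhiE; apply: Z1_ext => h x /=.
    rewrite -[LHS]/((a *: f (x + h) + g (x + h)) - (a *: f x + g x)).
    by rewrite opprD addrACA -scalerBr.
  by rewrite /lip_class pi_lmquotD pi_lmquotZ.
pose PhiL := GRing.isLinear.Build _ _ _ _ Phi lin.
pose PhiH : {linear lipmod A E -> Z1 A E} := HB.pack Phi PhiL.
have PhiHE f : PhiH (lip_class f) = cob f := PhiE f.
exists PhiH; split.
- by move=> f h x; rewrite PhiHE.
- exists (fun b => lip_class (Lip (primitive_lip A0 Acl b))).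
    move=> q; have [f ->] := surj q; apply/(coboundary_eq A0 Acl).
    by rewrite coboundary_primitive PhiHE.
  by move=> b; rewrite PhiHE; exact: coboundary_primitive.
- move=> q; have [f ->] := surj q.
  by rewrite lipmod_normE PhiHE; exact: Z1norm_coboundary.
Qed.
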